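(* Let $S$ be a Seidel matrix of order $n$ with spectrum $\{ [\lambda]^{a}, [\mu]^{b}, [\nu]^{1} \}$, where $a$ and $b$ are positive integers. Then the switching class of $S$ contains a strongly regular graph (in particular, a regular graph) whose multiset of adjacency eigenvalues consists of $(-1-\lambda)/2$ taken $a$ times, $(-1-\mu)/2$ taken $b$ times, and $(n-1-\nu)/2$ taken once.
   Context: A Seidel matrix is a symmetric $\{0,\pm1\}$-matrix with zero diagonal and all off-diagonal entries nonzero. The notation $\{[\lambda]^a,[\mu]^b,[\nu]^1\}$ for the spectrum of $S$ means that $S$ has precisely three distinct eigenvalues $\lambda,\mu,\nu$ (pairwise distinct, in no particular order) with multiplicities $a,b,1$. Two integer matrices $X,Y$ of order $n$ are switching equivalent if $X=P^{\top}YP$ for some signed permutation matrix $P$. The underlying graph of a Seidel matrix $S$ is the graph with adjacency matrix $(J-I-S)/2$, where $J$ is the all-ones matrix and $I$ the identity matrix. The switching class of $S$ is the set of underlying graphs of Seidel matrices that are switching equivalent to $S$. A strongly regular graph is a regular graph, neither complete nor empty, in which the number of common neighbours of two distinct vertices depends only on whether they are adjacent or not (connectedness of the graph or its complement is not required). *)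

(* Defs.v *)
From mathcomp Require Import all_boot all_order all_fingroup all_algebra.

Set Implicit Arguments.
Unset Strict Implicit.
Unset Printing Implicit Defensive.

Import Order.TTheory GRing.Theory Num.Theory.
Local Open Scope ring_scope.

Definition seidel (n : nat) (M : 'M[int]_n) : Prop :=
  [/\ M^T = M, forall i, M i i = 0
    & forall i j, i != j -> M i j = 1 \/ M i j = -1].

(* The multiset of eigenvalues of A, counted with (algebraic) multiplicity, is
   the list s up to reordering; for real symmetric A, algebraic and geometric
   multiplicities agree. *)
Definition has_spectrum (R : comNzRingType) (n : nat) (A : 'M[R]_n)
    (s : seq R) : Prop :=
  char_poly A = \prod_(x <- s) ('X - x%:P).

(* Equivalently: entries in {0, 1, -1}, exactly one of them nonzero in each row
   and in each column. *)
Definition signed_perm_mx (n : nat) (P : 'M[int]_n) : Prop :=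
  is_perm_mx (map_mx (fun x : int => `|x|) P).

Definition switching_equivalent (n : nat) (X Y : 'M[int]_n) : Prop :=
  exists2 P : 'M[int]_n, signed_perm_mx P & X = P^T *m Y *m P.

Definition simple_graph (V : finType) (e : rel V) : Prop :=
  symmetric e /\ irreflexive e.

Definition adjacency_mx (R : nzRingType) (n : nat) (e : rel 'I_n) : 'M[R]_n :=
  \matrix_(i, j) (e i j)%:R.

Definition underlying_graph (n : nat) (M : 'M[int]_n) (e : rel 'I_n) : Prop :=
  simple_graph e /\
  adjacency_mx rat e
    = 2^-1 *: (const_mx 1 - 1%:M - map_mx (fun z : int => z%:~R) M).

Definition in_switching_class (n : nat) (M : 'M[int]_n) (e : rel 'I_n) : Prop :=
  exists M' : 'M[int]_n,
    [/\ seidel M', switching_equivalent M' M & underlying_graph M' e].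

Definition neighbours (V : finType) (e : rel V) (x : V) : {set V} :=
  [set y | e x y].

Definition regular_graph (V : finType) (e : rel V) : Prop :=
  exists k : nat, forall x, #|neighbours e x| = k.

Definition complete_graph (V : finType) (e : rel V) : Prop :=
  forall x y, x != y -> e x y.

Definition empty_graph (V : finType) (e : rel V) : Prop :=
  forall x y, ~~ e x y.

Definition strongly_regular (V : finType) (e : rel V) : Prop :=
  [/\ simple_graph e, regular_graph e, ~ complete_graph e, ~ empty_graph e
    & exists c d : nat, forall x y, x != y ->
        #|neighbours e x :&: neighbours e y| = if e x y then c else d].

(* Main.v *)
Require Import Defs.
From mathcomp Require Import all_boot all_order all_fingroup all_algebra.
From mathcomp Require Import ring.

Set Implicit Arguments.
Unset Strict Implicit.
Unset Printing Implicit Defensive.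

Import Order.TTheory GRing.Theory Num.Theory.
Local Open Scope ring_scope.

(* As S is symmetric and its characteristic polynomial splits, S is
   diagonalizable, so T := (S - lambda)(S - mu) kills every eigenvector except
   the one for the simple eigenvalue nu: T is symmetric of rank one. Since S^2
   has constant diagonal n - 1 and S has zero diagonal, T has constant diagonal
   t <> 0, hence T_jk = t s_j s_k for signs s_j. Switching S with respect to s
   turns T into t J. For the switched matrix S', the relation (S' - nu) J = 0
   gives regularity, (S' - lambda)(S' - mu) = t J gives the constancy of the
   numbers of common neighbours, and the adjacency matrix (J - I - S')/2 is a
   polynomial in S', from which its spectrum is read off. *)

(** * Linear algebra: symmetric matrices, diagonalization, polynomials in a matrix *)

Lemma mulmx_tr_eq0 (R : realDomainType) (m n : nat) (X : 'M[R]_(m, n)) :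
  X^T *m X = 0 -> X = 0.
Proof.
move=> X0; apply/matrixP => i j; rewrite mxE.
have /psumr_eq0P E : forall k, true -> 0 <= X k j ^+ 2.
  by move=> k _; apply: sqr_ge0.
apply/eqP; rewrite -sqrf_eq0; apply/eqP/E => //.
have /matrixP/(_ j j) := X0; rewrite !mxE; apply: etrans.
by apply: eq_bigr => k _; rewrite !mxE expr2.
Qed.

(** By symmetry of [A], the Gram matrix of [A * B] is [B^T * (A * A * B)], and a real matrix with
    zero Gram matrix is zero. *)
Lemma symmetric_sqr_mul_eq0 (R : realDomainType) (n : nat)
    (A B : 'M[R]_n.+1) :
  A^T = A -> A * A * B = 0 -> A * B = 0.
Proof.
move=> symA AAB0; apply: mulmx_tr_eq0.
by rewrite -!mulmxE trmx_mul symA -mulmxA (mulmxA A) mulmxE AAB0 mulr0.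
Qed.

Lemma trmx_horner_XsubC (R : comNzRingType) (n : nat) (A : 'M[R]_n.+1)
    (x : R) :
  A^T = A -> (horner_mx A ('X - x%:P))^T = horner_mx A ('X - x%:P).
Proof.
by move=> symA; rewrite rmorphB /= horner_mx_X horner_mx_C linearB /=
  tr_scalar_mx symA.
Qed.

(** Each factor [A - x] is symmetric, so its square in an annihilating product may be replaced by
    the factor itself. [B] is arbitrary so that the induction can absorb factors into it. *)
Lemma horner_mx_prod_undup (R : realDomainType) (n : nat) (A : 'M[R]_n.+1)
    (s : seq R) (B : 'M[R]_n.+1) :
  A^T = A ->
  horner_mx A (\prod_(x <- s) ('X - x%:P)) * B = 0 ->
  horner_mx A (\prod_(x <- undup s) ('X - x%:P)) * B = 0.
Proof.
move=> symA; elim: s B => [|x s IHs] B //=.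
rewrite big_cons mulrC rmorphM /= -mulrA => /IHs.
case: ifP => [xs|_]; last first.
  by rewrite mulrA -rmorphM /= mulrC big_cons.
(* The product over [undup s] already contains ['X - x], so the hypothesis carries this factor
   squared. *)
have xu : x \in undup s by rewrite mem_undup.
rewrite (big_rem x) //= mulrA -rmorphM mulrAC !rmorphM /= -!mulrA => H.
apply: symmetric_sqr_mul_eq0; first exact: trmx_horner_XsubC.
by rewrite -mulrA.
Qed.

Lemma char_poly_conj (R : comUnitRingType) (n : nat) (P A : 'M[R]_n) :
  P \in unitmx -> char_poly (invmx P *m A *m P) = char_poly A.
Proof.
move=> Pu.
have PK : map_mx polyC (invmx P) *m map_mx polyC P = 1%:M.
  by rewrite -map_mxM mulVmx // map_mx1.
have -> : char_poly (invmx P *m A *m P) =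
    \det (map_mx polyC (invmx P) *m char_poly_mx A *m map_mx polyC P).
  rewrite /char_poly /char_poly_mx mulmxBr mulmxBl scalar_mxC !map_mxM.
  by rewrite -(mulmxA 'X%:M) PK mulmx1.
by rewrite !det_mulmx mulrAC -det_mulmx PK det1 mul1r.
Qed.

Lemma char_poly_diag (R : comNzRingType) (n : nat) (d : 'rV[R]_n) :
  char_poly (diag_mx d) = \prod_(x <- [seq d 0 i | i : 'I_n]) ('X - x%:P).
Proof.
rewrite char_poly_trig ?diag_mx_is_trig // big_image /=.
by apply: eq_bigr => i _; rewrite mxE eqxx.
Qed.

(** By Cayley-Hamilton and the removal of repeated factors, the minimal polynomial divides a product
    of distinct linear factors. Comparing characteristic polynomials identifies the diagonal with
    [s]. *)
Lemma symmetric_split_diagonalizable (R : realFieldType) (n : nat)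
    (A : 'M[R]_n.+1) (s : seq R) :
  A^T = A -> has_spectrum A s ->
  exists P d, [/\ P \in unitmx, A = invmx P *m diag_mx d *m P
                & perm_eq [seq d 0 i | i : 'I_n.+1] s].
Proof.
move=> symA spA.
have /diagonalizableP [P Pu /similar_diagPex [d /(similarLR Pu)]] :
    exists2 rs, uniq rs & mxminpoly A %| \prod_(x <- rs) ('X - x%:P).
  exists (undup s); rewrite ?undup_uniq //; apply: mxminpoly_min.
  rewrite -[LHS]mulr1; apply: horner_mx_prod_undup => //.
  by rewrite -spA Cayley_Hamilton mul0r.
rewrite conjVmx // => defA; exists P, d; split=> //.
by apply: prod_XsubC_eq; rewrite -char_poly_diag -spA defA char_poly_conj.
Qed.

Lemma has_spectrum_horner (R : fieldType) (n : nat) (A P : 'M[R]_n.+1)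
    (d : 'rV[R]_n.+1) (s : seq R) (q : {poly R}) :
  P \in unitmx -> A = invmx P *m diag_mx d *m P ->
  perm_eq [seq d 0 i | i : 'I_n.+1] s ->
  has_spectrum (horner_mx A q) [seq q.[x] | x <- s].
Proof.
move=> Pu -> ds; rewrite /has_spectrum horner_mx_uconjC //.
rewrite horner_mx_diag char_poly_conj // char_poly_diag.
rewrite [RHS]big_map -(perm_big _ ds) !big_image /=.
by apply: eq_bigr => i _; rewrite mxE.
Qed.

(* All the 2 x 2 minors of T vanish, so with T j j = t each T j k is t or - t,
   and any one row gives the signs. *)
Lemma symmetric_rank1_signs (F : fieldType) (n : nat) (T : 'M[F]_n) (t : F)
    (i : 'I_n) :
  t != 0 -> T^T = T -> (forall j, T j j = t) ->
  (forall j k l m, T j k * T l m = T j m * T l k) ->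
  exists s : 'I_n -> bool, forall j k, T j k = (-1) ^+ s j * t * (-1) ^+ s k.
Proof.
move=> t0 symT Tdiag Tminor.
have TC j k : T k j = T j k by rewrite -{1}symT mxE.
have Tpm j : (T j i == t) || (T j i == - t).
  by rewrite -eqf_sqr expr2 -{1}TC Tminor !Tdiag expr2.
exists (fun j => T j i != t) => j k; apply: (mulIf t0).
rewrite -{1}(Tdiag i) Tminor (TC k).
have sgnE l : T l i = (-1) ^+ (T l i != t) * t.
  have := Tpm l; case: eqP => [-> _ | _ /eqP ->]; first by rewrite mul1r.
  by rewrite expr1 mulN1r.
by rewrite [in LHS](sgnE j) [in LHS](sgnE k); ring.
Qed.

(** Spectral decomposition: column [i] of [invmx P] times row [i] of [P] is the projection belonging
    to [d 0 i]. *)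
Lemma horner_mx_conj_diag (R : fieldType) (n : nat) (A P : 'M[R]_n.+1)
    (d : 'rV[R]_n.+1) (q : {poly R}) (j k : 'I_n.+1) :
  P \in unitmx -> A = invmx P *m diag_mx d *m P ->
  horner_mx A q j k = \sum_i q.[d 0 i] * (invmx P j i * P i k).
Proof.
move=> Pu ->; rewrite horner_mx_uconjC // horner_mx_diag mxE.
by apply: eq_bigr => i _; rewrite mul_mx_diag !mxE mulrCA mulrA.
Qed.

Lemma horner_mx_eq0P (R : fieldType) (n : nat) (A P : 'M[R]_n.+1)
    (d : 'rV[R]_n.+1) (q : {poly R}) :
  P \in unitmx -> A = invmx P *m diag_mx d *m P ->
  horner_mx A q = 0 <-> forall i, root q (d 0 i).
Proof.
move=> Pu defA; split=> [q0 i | q0].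
  have := congr1 (fun B => (P *m B *m invmx P) i i) q0.
  rewrite {1}defA horner_mx_uconjC // horner_mx_diag mulmx0 mul0mx.
  rewrite !mulmxA mulmxV // mul1mx mulmxK // !mxE eqxx mulr1n.
  by move/rootP.
apply/matrixP => j k; rewrite (horner_mx_conj_diag _ _ _ Pu defA) mxE.
by apply: big1 => i _; rewrite (rootP (q0 i)) mul0r.
Qed.

Lemma count1_image (T : eqType) (I : finType) (f : I -> T) (x : T) :
  count_mem x [seq f i | i : I] = 1%N ->
  exists2 i, f i = x & forall j, j != i -> f j != x.
Proof.
rewrite -sum1_count big_image_cond /= => c1.
have /eqP/fintype.card1P [i iE] : #|[pred i | f i == x]| = 1%N.
  by rewrite -sum1_card -[RHS]c1; apply: eq_bigl.
exists i => [|j /negPf ji]; first by apply/eqP; have := iE i; rewrite !inE eqxx.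
by have := iE j; rewrite !inE ji => ->.
Qed.

(** * Seidel matrices and switching *)

Section Seidel.

Variable n : nat.
Implicit Type M : 'M[int]_n.

Local Notation inR R M := (map_mx (fun z : int => z%:~R : R) M).

(** The signed permutation matrix with trivial permutation; conjugation by it switches at the
    vertices where [s] is true. *)
Definition sign_mx (K : pzRingType) (s : 'I_n -> bool) : 'M[K]_n :=
  diag_mx (\row_j (-1) ^+ s j).

Lemma sign_mxK (K : pzRingType) (s : 'I_n -> bool) :
  sign_mx K s *m sign_mx K s = 1%:M.
Proof.
apply/matrixP => i j; rewrite mul_diag_mx !mxE.
by case: eqP => _; rewrite ?mulr0 // !mulr1n -expr2 sqrr_sign.
Qed.

Definition switch (s : 'I_n -> bool) M : 'M[int]_n :=
  sign_mx int s *m M *m sign_mx int s.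

Lemma switchE s M i j : switch s M i j = (-1) ^+ s i * M i j * (-1) ^+ s j.
Proof. by rewrite /switch mul_mx_diag mul_diag_mx !mxE. Qed.

Lemma map_switch (K : pzRingType) s M :
  inR K (switch s M) = sign_mx K s *m inR K M *m sign_mx K s.
Proof.
apply/matrixP => i j; rewrite [LHS]mxE switchE mul_mx_diag mul_diag_mx !mxE.
by rewrite !rmorphM !rmorph_sign.
Qed.

Lemma seidel_switch s M : seidel M -> seidel (switch s M).
Proof.
move=> [symM diagM offM]; split=> [|i|i j ij].
- by rewrite /switch !trmx_mul tr_diag_mx symM mulmxA.
- by rewrite switchE diagM mulr0 mul0r.
rewrite switchE; case: (offM i j ij) => ->; case: (s i); case: (s j);
  by [left | right].
Qed.

Lemma switch_equivalent s M : switching_equivalent (switch s M) M.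
Proof.
exists (sign_mx int s); last by rewrite tr_diag_mx.
rewrite /signed_perm_mx (_ : map_mx _ _ = 1%:M) ?is_perm_mx1 //.
apply/matrixP => i j; rewrite !mxE.
by case: eqP => _; rewrite ?normr0 // mulr1n normr_sign.
Qed.

(** * Underlying graphs and counts of neighbours *)

Definition graph_of M : rel 'I_n := fun i j => M i j == -1.

Lemma simple_graph_of M : seidel M -> simple_graph (graph_of M).
Proof.
move=> [symM diagM _]; split=> [i j | i]; last by rewrite /graph_of diagM.
by rewrite /graph_of -{1}symM mxE.
Qed.

Lemma adjacency_graph_of (K : numFieldType) M : seidel M ->
  adjacency_mx K (graph_of M) = 2^-1 *: (const_mx 1 - 1%:M - inR K M).
Proof.
move=> [symM diagM offM]; apply/matrixP => i j; rewrite !mxE /graph_of.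
have [<- | ij] := eqVneq i j.
  by rewrite diagM /= mulr1n subrr sub0r oppr0 mulr0.
by case: (offM i j ij) => -> /=; rewrite ?mulrN1z; field.
Qed.

Lemma underlying_graph_of M : seidel M -> underlying_graph M (graph_of M).
Proof.
by move=> sM; split; [exact: simple_graph_of | exact: adjacency_graph_of].
Qed.

Lemma seidel_sqr_diag M i : seidel M -> (M *m M) i i = n%:R - 1.
Proof.
move=> [symM diagM offM]; rewrite mxE (bigD1 i) //= diagM mul0r add0r.
rewrite (eq_bigr (fun=> 1)) => [|k ki].
  rewrite sumr_const cardC1 card_ord.
  by case: n i => [[//]|m] _ /=; rewrite -addn1 natrD addrK.
rewrite -{2}symM mxE; rewrite eq_sym in ki.
by case: (offM i k ki) => ->.
Qed.

Lemma adjacency_mul_const (K : nzRingType) (e : rel 'I_n) x y :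
  (adjacency_mx K e *m const_mx 1 : 'M_n) x y = #|neighbours e x|%:R.
Proof.
rewrite mxE -sum1_card natr_sum [RHS]big_mkcond.
by apply: eq_bigr => z _; rewrite !mxE mulr1 inE; case: e.
Qed.

Lemma adjacency_sqr (K : nzRingType) (e : rel 'I_n) x y : symmetric e ->
  (adjacency_mx K e *m adjacency_mx K e) x y
    = #|neighbours e x :&: neighbours e y|%:R.
Proof.
move=> symE; rewrite mxE -sum1_card natr_sum [RHS]big_mkcond.
apply: eq_bigr => z _; rewrite !mxE !inE (symE y z).
by rewrite -natrM mulnb; case: ifP.
Qed.

Lemma const_mx1_sqr (K : pzRingType) :
  (const_mx 1 : 'M[K]_n) *m const_mx 1 = n%:R *: const_mx 1 :> 'M_n.
Proof.
apply/matrixP => i j; rewrite !mxE mulr1.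
under eq_bigr do rewrite !mxE mulr1.
by rewrite sumr_const card_ord.
Qed.

(** The entries of [A J] are the degrees, and for [A = (J - I - M) / 2] the relation [M J = nu J]
    makes [A J] a multiple of [J]. *)
Lemma seidel_regular_graph (K : numFieldType) M (nu : K) :
  seidel M -> inR K M *m const_mx 1 = nu *: const_mx 1 :> 'M_n ->
  regular_graph (graph_of M).
Proof.
move=> sM MJ; case: (pickP 'I_n) => [x0 _ | no]; last first.
  by exists 0%N => x; have := no x.
exists #|neighbours (graph_of M) x0| => x.
apply/eqP; rewrite -(eqr_nat K) -!(adjacency_mul_const _ _ _ x0).
rewrite adjacency_graph_of // -scalemxAl !mulmxBl const_mx1_sqr mul1mx MJ.
by rewrite !mxE.
Qed.

(** Expanding the square of [(J - I - M) / 2] leaves a combination of [J], [I] and [M], whose entry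
    off the diagonal depends only on [M x y]. *)
Lemma seidel_common_neighbours (K : numFieldType) M (al be t nu : K) :
  seidel M -> inR K M *m const_mx 1 = nu *: const_mx 1 :> 'M_n ->
  inR K M *m inR K M = al *: inR K M + be%:M + const_mx t ->
  exists c d : nat, forall x y, x != y ->
    #|neighbours (graph_of M) x :&: neighbours (graph_of M) y|
      = if graph_of M x y then c else d.
Proof.
move=> sM MJ MM; have [symM diagM offM] := sM.
set e := graph_of M; have [symE _] := simple_graph_of sM.
have JM : (const_mx 1 : 'M_n) *m inR K M = nu *: const_mx 1 :> 'M_n.
  apply: trmx_inj; rewrite trmx_mul linearZ /= trmx_const map_trmx symM.
  exact: MJ.
(* The off-diagonal entry of the squared adjacency matrix; the sign [(-1) ^+ b] stands for [M x y],
   which is -1 on edges. *)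
pose F b : K := 2^-1 * (2^-1 * (n%:R - 2 - 2 * nu + t
  + (al + 2) * (-1) ^+ b)).
have common x y : x != y ->
    #|neighbours e x :&: neighbours e y|%:R = F (e x y) :> K.
  move=> xy; rewrite -adjacency_sqr // adjacency_graph_of //.
  rewrite -scalemxAl -scalemxAr !mulmxBl !mulmxBr const_mx1_sqr !mul1mx !mulmx1.
  rewrite MJ JM MM /F /e /graph_of !mxE (negPf xy).
  by case: (offM x y xy) => -> /=; rewrite ?mulrN1z ?mulr1n ?mulr0n; field.
(* The common value over the pairs of a given adjacency, or 0 if there is none. *)
pose val_of b := if [pick p | (p.1 != p.2) && (e p.1 p.2 == b)] is Some p
  then #|neighbours e p.1 :&: neighbours e p.2| else 0%N.
exists (val_of true), (val_of false) => x y xy.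
have -> : (if e x y then val_of true else val_of false) = val_of (e x y).
  by case: (e x y).
rewrite /val_of; case: pickP => [p /andP[pp /eqP ep] | /(_ (x, y))].
  by apply/eqP; rewrite -(eqr_nat K) !common // ep.
by rewrite /= xy eqxx.
Qed.

End Seidel.

(** Such a matrix is [c (J - I)] of order [n + 1], and [J] has no eigenvalues besides 0 and [n + 1].
    This serves to exclude complete and empty graphs. *)
Lemma seidel_const_sign (R : numFieldType) (n : nat) (M : 'M[int]_n.+1)
    (c : R) :
  seidel M -> c ^+ 2 = 1 -> (forall i j, i != j -> (M i j)%:~R = c) ->
  horner_mx (map_mx (fun z : int => z%:~R : R) M)
    (('X - (- c)%:P) * ('X - (c * n%:R)%:P)) = 0.
Proof.
move=> [_ diagM _] c1 offM.
set J : 'M[R]_n.+1 := const_mx 1.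
have -> : map_mx (fun z : int => z%:~R : R) M = c *: J - c%:M.
  apply/matrixP => i j; rewrite !mxE; case: eqVneq => [<- | /offM ->].
    by rewrite diagM mulr1 subrr.
  by rewrite mulr1 subr0.
rewrite rmorphM /= !rmorphB /= !horner_mx_X !horner_mx_C rmorphN /= opprK subrK.
rewrite !mulrBr -scalerAl -scalerAr -mulmxE const_mx1_sqr.
rewrite -!scalemxAl !mul_mx_scalar; apply/matrixP => i j.
by rewrite !mxE -natr1; ring.
Qed.

(** * From the spectrum to a strongly regular graph in the switching class *)

Theorem corollary5p4 (R : rcfType) (n : nat) (S : 'M[int]_n)
    (lambda mu nu : R) (a b : nat) :
  seidel S ->
  (0 < a)%N -> (0 < b)%N ->
  uniq [:: lambda; mu; nu] ->
  has_spectrum (map_mx (fun z : int => z%:~R) S)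
    (nseq a lambda ++ nseq b mu ++ [:: nu]) ->
  exists e : rel 'I_n,
    [/\ in_switching_class S e,
        strongly_regular e
      & has_spectrum (adjacency_mx R e)
          (nseq a ((-1 - lambda) / 2) ++ nseq b ((-1 - mu) / 2)
             ++ [:: (n%:R - 1 - nu) / 2])].
Proof.
move=> sS a0 b0 distinct spS.
(* Order 0 is impossible because the spectrum lists [a + b + 1] values; from here on the order is
   [n.+1]. *)
case: n S sS spS => [|n] S sS spS.
  have := congr1 (fun p : {poly R} => size p) spS.
  by rewrite size_char_poly size_prod_XsubC !size_cat !size_nseq /= addn1 addnS.
set M := map_mx _ S in spS.
have symM : M^T = M by rewrite map_trmx; case: sS => ->.
have [P [d [Pu defM dE]]] := symmetric_split_diagonalizable symM spS.
move: (distinct); rewrite /= !inE negb_or andbT => /andP[/andP[lm ln] mn].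
have dmem x : (x \in [seq d 0 i | i : 'I_n.+1]) = (x \in [:: lambda; mu; nu]).
  by rewrite (perm_mem dE) !mem_cat !mem_nseq a0 b0 !inE.
have dcases i : d 0 i \in [:: lambda; mu; nu].
  by rewrite -dmem; apply: image_f.
have [i0 di0 dne] : exists2 i, d 0 i = nu & forall j, j != i -> d 0 j != nu.
  apply: count1_image; have /seq.permP -> := dE.
  by rewrite !count_cat !count_nseq /= eqxx (negPf ln) (negPf mn).
pose p := ('X - lambda%:P) * ('X - mu%:P) : {poly R}.
pose kappa := p.[nu].
have pE x : p.[x] = (x - lambda) * (x - mu) by rewrite !hornerE.
have kappa0 : kappa != 0.
  by rewrite /kappa pE mulf_neq0 // subr_eq0 eq_sym.
have pd i : i != i0 -> p.[d 0 i] = 0.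
  move=> /dne; have := dcases i; rewrite !inE pE orbA.
  by case/orP => [/orP[]/eqP-> _|/eqP->]; rewrite ?subrr ?mul0r ?mulr0 ?eqxx.
pose T := horner_mx M p.
(* Only the term at [i0] survives, so [T] is a column times a row and its 2 x 2 minors vanish. *)
have TE j k : T j k = kappa * (invmx P j i0 * P i0 k).
  rewrite /T (horner_mx_conj_diag _ _ _ Pu defM) (bigD1 i0) //= di0.
  by rewrite big1 ?addr0 // => i /pd ->; rewrite mul0r.
have TM : T = M *m M - (lambda + mu) *: M + (lambda * mu)%:M.
  rewrite /T rmorphM /= !rmorphB /= !horner_mx_X !horner_mx_C.
  rewrite mulrBl !mulrBr -!mulmxE !mul_scalar_mx mul_mx_scalar scale_scalar_mx.
  by apply/matrixP => j k; rewrite !mxE; ring.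
have symT : T^T = T.
  by rewrite TM !linearD !linearN /= linearZ /= trmx_mul tr_scalar_mx symM.
pose t := T i0 i0.
have MM : M *m M = map_mx intr (S *m S) by rewrite map_mxM.
have Tdiag j : T j j = t.
  have T_ k : T k k = ((n.+1)%:R - 1) + lambda * mu.
    have : (M *m M) k k = n.+1%:R - 1.
      by rewrite MM mxE (seidel_sqr_diag k sS) rmorphB /= rmorph_nat.
    rewrite TM; move: (M *m M) => M2 M2k; rewrite !mxE M2k.
    by case: sS => _ -> _; rewrite eqxx mulr0 subr0.
  by rewrite /t !T_.
(* Both sides are the trace of [T]: one from its constant diagonal, the other from its rank-one form
   and [P *m invmx P = 1]. *)
have nt : n.+1%:R * t = kappa.
  have := congr1 (fun B : 'M_n.+1 => kappa * B i0 i0) (mulmxV Pu).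
  rewrite !mxE eqxx mulr1 => <-.
  rewrite mulr_sumr mulr_natl -[in LHS](card_ord n.+1) -sumr_const.
  by apply: eq_bigr => j _; rewrite -(Tdiag j) TE mulrC; ring.
have t0 : t != 0 by apply: contra_neq kappa0 => t0; rewrite -nt t0 mulr0.
have [s sE] : exists s : 'I_n.+1 -> bool,
    forall j k, T j k = (-1) ^+ s j * t * (-1) ^+ s k.
  apply: (symmetric_rank1_signs i0) => // j k l m.
  by rewrite !TE; ring.
pose S' := switch s S; pose M' := map_mx (fun z : int => z%:~R : R) S'.
pose D := sign_mx R s.
have DD : D *m D = 1%:M := sign_mxK R s.
have [Du _] := mulmx1_unit DD.
have Dinv : invmx D = D by rewrite -[LHS]mulmx1 -DD mulmxA mulVmx // mul1mx.
have sS' : seidel S' := seidel_switch s sS.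
have defM'D : M' = invmx D *m M *m D by rewrite Dinv /M' map_switch.
(* Switching is a conjugation by [D], so the same [d] diagonalizes [M'], now through [P *m D]. *)
pose Q := P *m D.
have Qu : Q \in unitmx by rewrite unitmx_mul Pu.
have defM' : M' = invmx Q *m diag_mx d *m Q.
  rewrite defM'D defM /Q !mulmxA; congr (_ *m _ *m _ *m _).
  by symmetry; apply: (@invrM _ P D).
have T'E : horner_mx M' p = const_mx t.
  rewrite defM'D horner_mx_uconjC // -/T Dinv; apply/matrixP => j k.
  rewrite mul_mx_diag mul_diag_mx !mxE sE !mulrA -expr2 sqrr_sign mul1r.
  by rewrite -mulrA -expr2 sqrr_sign mulr1.
have T'J : horner_mx M' p = t *: const_mx 1.
  by rewrite T'E; apply/matrixP => j k; rewrite !mxE mulr1.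
have M'J : M' *m const_mx 1 = nu *: const_mx 1 :> 'M_n.+1.
  (* This polynomial vanishes at every eigenvalue, so [(M' - nu) (t J) = 0], and [t] can be
     cancelled. *)
  have : horner_mx M' (('X - nu%:P) * p) = 0.
    apply/(horner_mx_eq0P _ Qu defM') => i; rewrite rootM root_XsubC.
    have [-> | /pd pd0] := eqVneq i i0; first by rewrite di0 eqxx.
    by rewrite orbC /root pd0 eqxx.
  rewrite rmorphM /= T'J rmorphB /= horner_mx_X horner_mx_C mulrBl.
  move/eqP; rewrite subr_eq0 -scalerAr -mulmxE mul_scalar_mx scalemxAr => /eqP.
  rewrite -!scalemxAr scalerA mulrC -scalerA.
  exact: scalerI.
have M'M' : M' *m M' = (lambda + mu) *: M' + (- (lambda * mu))%:M + const_mx t.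
  rewrite -T'E rmorphM /= !rmorphB /= !horner_mx_X !horner_mx_C.
  rewrite mulrBl !mulrBr -!mulmxE !mul_scalar_mx mul_mx_scalar scale_scalar_mx.
  apply/matrixP => i j; rewrite !mxE; ring.
(* Three distinct eigenvalues do not fit among the two values [- c] and [c * n]. *)
have not_const (c : R) : c ^+ 2 = 1 ->
    ~ (forall i j, i != j -> (S' i j)%:~R = c).
  move=> c1 /(seidel_const_sign sS' c1) /(horner_mx_eq0P _ Qu defM') dc.
  have : {subset [:: lambda; mu; nu] <= [:: - c; c * n%:R]}.
    move=> x; rewrite -dmem => /mapP [i _ ->].
    by have := dc i; rewrite rootM !root_XsubC !inE.
  by move/(uniq_leq_size distinct).
exists (graph_of S'); split.
- by exists S'; split=> //; [exact: switch_equivalent | exact: underlying_graph_of].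
- split.
  + exact: simple_graph_of.
  + exact: seidel_regular_graph sS' M'J.
  (* Edges are the entries -1, so a complete graph means [c = -1] and an empty one [c = 1]. *)
  + move=> complete; apply: (not_const (-1)); first by rewrite sqrrN expr1n.
    by move=> i j /complete /eqP ->; rewrite mulrN1z.
  + move=> empty; apply: (not_const 1); first by rewrite expr1n.
    case: sS' => _ _ off i j ij; case: (off i j ij) => [-> //|E].
    by have := empty i j; rewrite /graph_of E eqxx.
  + exact: seidel_common_neighbours sS' M'J M'M'.
(* This is [(J - I - M') / 2] with [J] written as [t^-1 p(M')]. At [lambda] and [mu] the term in [p]
   vanishes; at [nu] it is [kappa / t], the order [n.+1]. *)
pose q : {poly R} := 2^-1 *: (t^-1 *: p - 1 - 'X).
have qE x : q.[x] = 2^-1 * (t^-1 * p.[x] - 1 - x) by rewrite !hornerE.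
have -> : adjacency_mx R (graph_of S') = horner_mx M' q.
  rewrite adjacency_graph_of // linearZ /= !rmorphB /= linearZ /= T'J.
  by rewrite !rmorph1 horner_mx_X scalerA mulVf // scale1r.
have := has_spectrum_horner q Qu defM' dE.
rewrite !map_cat !map_nseq /= !qE -/kappa -nt mulrCA mulVf // mulr1 !pE !subrr.
rewrite mul0r !mulr0 sub0r.
by rewrite !(mulrC 2^-1).
Qed.
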